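(* For a compact space $X$, the following statements are equivalent: (1) There is a weak $c$-skeleton $(\{F_s:s\in\Gamma\},\psi)$ on $X$ which satisfies: $( * )$ for every $s\le t$ in $\Gamma$, $x\in X$, $z\in\bigcap_{U\in\mathcal N(\psi(t),x)}\overline{U\cap F_t}$ and $V\in\mathcal N(\psi(s),x)$, there is $W\in\mathcal N(\psi(s),z)$ such that $\overline{W\cap F_s}\subseteq\overline{V\cap F_s}$; and $( ** )$ if $\langle s_n\rangle_{n<\omega}$ is an increasing sequence in $\Gamma$ with $s=\sup\{s_n : n<\omega\}$, then for each $x\in X$ and $U\in\mathcal N(\psi(s),x)$ there is $m<\omega$ such that $\overline{U\cap F_s}\cap V\cap F_{s_n}\ne\emptyset$ for every $n\ge m$ and every $V\in\mathcal N(\psi(s_n),x)$. (2) There is an $r$-skeleton on $X$.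
   Context: All spaces are Tychonoff; closures are in $X$. $[\tau]^{\le\omega}$ is the set of countable subsets of $\tau$. A retraction in $X$ is a continuous map $r:X\to X$ with $r\circ r=r$. A space is cosmic if it has a countable network. A partially ordered set $\Gamma$ is up-directed if any two elements have a common upper bound, and $\sigma$-complete if every increasing sequence in $\Gamma$ has a supremum in $\Gamma$. An $r$-skeleton on a space $X$ is a family $\{r_s:s\in\Gamma\}$ of retractions in $X$, indexed by an up-directed $\sigma$-complete partially ordered set $\Gamma$, such that: (i) $r_s(X)$ is cosmic for each $s\in\Gamma$; (ii) $r_s=r_s\circ r_t=r_t\circ r_s$ whenever $s\le t$; (iii) if $\langle s_n\rangle_{n<\omega}\subseteq\Gamma$ is increasing and $s=\sup\{s_n:n<\omega\}$, then $r_s(x)=\lim_{n\to\infty}r_{s_n}(x)$ for each $x\in X$; (iv) $x=\lim_{s\in\Gamma}r_s(x)$ for each $x\in X$. Let $(X,\tau)$ be a space. If $\mathcal B$ is a base for a topology on $X$ and $x\in X$, put $\mathcal N(\mathcal B,x):=\{U\in\mathcal B:x\in U\}$. For a family $\{F_s:s\in\Gamma\}$ of closed subspaces of $X$, a function $\psi:\Gamma\to[\tau]^{\le\omega}$ is an assignment of bases for $\{F_s:s\in\Gamma\}$ if, for each $s\in\Gamma$, $\psi(s)$ is a base for a topology on $X$ (not necessarily $\tau$), $\psi(s)\upharpoonright_{F_s}:=\{U\cap F_s:U\in\psi(s)\}$ is a base for the subspace $F_s$ of $(X,\tau)$, and $\emptyset\notin\psi(s)\upharpoonright_{F_s}$.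 A pair $(\{F_s:s\in\Gamma\},\psi)$, with $\Gamma$ an up-directed $\sigma$-complete partially ordered set, is a weak $c$-skeleton on $X$ if: (1) $\{F_s:s\in\Gamma\}$ is a family of closed cosmic subspaces of $X$ with $F_s\subseteq F_t$ whenever $s\le t$ and $\bigcup_{s\in\Gamma}F_s$ dense in $X$; (2) $\psi$ is an assignment of bases for $\{F_s:s\in\Gamma\}$; (3) for each $s\in\Gamma$, if $x\in X$ and $z\in\bigcap_{U\in\mathcal N(\psi(s),x)}\overline{U\cap F_s}$, then for each $V\in\mathcal N(\psi(s),z)$ there is $U\in\mathcal N(\psi(s),x)$ such that $\overline{U\cap F_s}\subseteq V$. *)

(* Defs.v *)
From HB Require Import structures.
From mathcomp Require Import all_boot all_order.
From mathcomp Require Import boolp classical_sets functions cardinality.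
From mathcomp Require Import topology urysohn.

Set Implicit Arguments.
Unset Strict Implicit.
Unset Printing Implicit Defensive.

Local Open Scope classical_set_scope.

Definition tychonoff_space (X : topologicalType) : Prop :=
  accessible_space X /\ completely_regular_space X.

(* Network members are arbitrary, not necessarily open, sets. *)
Definition network (T : topologicalType) (N : set (set T)) : Prop :=
  forall (x : T) (U : set T), open U -> U x ->
    exists2 M, N M & M x /\ M `<=` U.

(* Used below on [set_type A], which carries the subspace topology. *)
Definition cosmic (T : topologicalType) : Prop :=
  exists2 N : set (set T), countable N & network N.

Section Topologies.
Variable T : Type.
Implicit Types O B : set (set T).

(* The empty subfamily gives [O set0]. *)
Definition is_topology O : Prop :=
  [/\ O setT, setI_closed O &
      forall C : set (set T), C `<=` O -> O (\bigcup_(V in C) V)].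

Definition base_of O B : Prop :=
  B `<=` O /\
  forall U, O U -> exists2 C : set (set T), C `<=` B & U = \bigcup_(V in C) V.

Definition base_for_some_topology B : Prop :=
  exists2 O : set (set T), is_topology O & base_of O B.

Definition trace B (F : set T) : set (set T) := [set U `&` F | U in B].

Definition members_at B (x : T) : set (set T) := [set U | B U /\ U x].

End Topologies.

Section Indices.
Context {d : Order.disp_t} (Gamma : porderType d).

Definition up_directed : Prop :=
  forall s t : Gamma, exists u : Gamma, (s <= u)%O /\ (t <= u)%O.

(* Sequences are increasing in the non-strict sense. *)
Definition increasing (u : nat -> Gamma) : Prop :=
  {homo u : m n / (m <= n)%N >-> (m <= n)%O}.

Definition is_sup (u : nat -> Gamma) (s : Gamma) : Prop :=
  supremums (range u) s.

Definition sigma_complete : Prop :=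
  forall u : nat -> Gamma, increasing u -> exists s, is_sup u s.

(* The filter of final segments; when [Gamma] is directed, convergence of an
   image of this filter is convergence of the corresponding net. *)
Definition tails : set_system Gamma :=
  filter_from setT (fun s => [set t : Gamma | (s <= t)%O]).

End Indices.

Arguments tails {d} Gamma _.

Section Skeletons.
Context {d : Order.disp_t} {Gamma : porderType d} {X : topologicalType}.

Definition retraction (r : X -> X) : Prop := continuous r /\ r \o r = r.

Record r_skeleton (r : Gamma -> X -> X) : Prop := {
  rsk_directed : up_directed Gamma ;
  rsk_complete : sigma_complete Gamma ;
  rsk_retraction : forall s, retraction (r s) ;
  rsk_cosmic : forall s, cosmic (set_type (range (r s))) ;
  rsk_compose : forall s t, (s <= t)%O ->
    r s = r s \o r t /\ r s = r t \o r s ;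
  rsk_sup : forall (u : nat -> Gamma) s, increasing u -> is_sup u s ->
    forall x, r (u n) x @[n --> \oo] --> r s x ;
  rsk_limit : forall x, r s x @[s --> tails Gamma] --> x
}.

Variables (F : Gamma -> set X) (psi : Gamma -> set (set X)).

Definition assignment_of_bases : Prop :=
  forall s, [/\ countable (psi s) /\ psi s `<=` open,
    base_for_some_topology (psi s),
    base_of (trace open (F s)) (trace (psi s) (F s)) &
    ~ trace (psi s) (F s) set0].

Definition core (s : Gamma) (x : X) : set X :=
  \bigcap_(U in members_at (psi s) x) closure (U `&` F s).

Record weak_c_skeleton : Prop := {
  wsk_directed : up_directed Gamma ;
  wsk_complete : sigma_complete Gamma ;
  wsk_closed : forall s, closed (F s) ;
  wsk_cosmic : forall s, cosmic (set_type (F s)) ;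
  wsk_mono : forall s t, (s <= t)%O -> F s `<=` F t ;
  wsk_dense : dense (\bigcup_s F s) ;
  wsk_bases : assignment_of_bases ;
  wsk_regular : forall s x z, core s x z ->
    forall V, members_at (psi s) z V ->
    exists2 U, members_at (psi s) x U & closure (U `&` F s) `<=` V
}.

Definition star_condition : Prop :=
  forall s t, (s <= t)%O -> forall x z, core t x z ->
  forall V, members_at (psi s) x V ->
  exists2 W, members_at (psi s) z W & closure (W `&` F s) `<=` closure (V `&` F s).

Definition double_star_condition : Prop :=
  forall (u : nat -> Gamma) s, increasing u -> is_sup u s ->
  forall x U, members_at (psi s) x U ->
  exists m : nat, forall n, (m <= n)%N ->
  forall V, members_at (psi (u n)) x V ->
  closure (U `&` F s) `&` V `&` F (u n) !=set0.

End Skeletons.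

(* Main.v *)
Require Import Defs.
From mathcomp Require Import all_boot all_order.
From mathcomp Require Import finmap boolp classical_sets functions cardinality.
From mathcomp Require Import topology urysohn.

Local Open Scope classical_set_scope.

(** From a weak c-skeleton to an r-skeleton.  For a point [x] and an index [s],
    the traces on [F s] of the members of [psi s] around [x] form a filter base,
    and [core s x] is its set of cluster points.  By compactness the core is not
    empty; condition (3) lets the sets [closure (U `&` F s)] enter any given
    neighbourhood of a point of the core ([core_near]), so the core is a single
    point [r s x].  The same lemma makes [r s] continuous, and [r s] is the
    identity on [F s], hence a retraction onto [F s].  Condition star says that
    [x] and [r t x] have the same image under [r s] when [s <= t]; condition
    double star places the cluster point [r (u n) x] inside
    [closure (U `&` F s)] for all large [n], which is convergence along
    increasing sequences.

    That [r s x] converges to [x] along the whole index set is a fact about any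
    such system of retractions of a compact space with a dense union of ranges
    ([compact_retractions_cvg]).  If it failed at [x], one could build an
    increasing sequence [u n] with [r (u n) x] far from [x] for [n > 0] and,
    alternately, points [y n] close to [x], lying in the range of [r (u n.+1)],
    such that [r (u i) (y n)] is still far from [x] whenever [0 < i <= n].  A cluster point [e]
    of the [y n] lies in the range of [r s], where [s] is the supremum, so
    [r (u i) e] converges to [r s e = e]; but [r (u i) e] is far from [x] for
    [i > 0] while [e] is close to it.

    From an r-skeleton to a weak c-skeleton.  A compact Hausdorff space with a
    countable network has a countable base ([cosmic_countable_base]).  Take
    [F s] the range of [r s] and let [psi s] consist of the preimages under
    [r s] of the members of a countable base of [F s].  Then [psi s] is a base
    of the topology pulled back along [r s], the core of [x] is [[set r s x]],
    and every condition reads as a property of the retractions. *)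

(** * Separation and retractions in compact spaces *)

(** Complete regularity separates two points by an entourage of some coarser
    uniformity; the sections of half of this entourage are disjoint
    neighbourhoods. *)
Lemma tychonoff_hausdorff {X : topologicalType} :
  tychonoff_space X -> hausdorff_space X.
Proof.
move=> [T1 creg] x y xy; apply: contrapT => /eqP nxy.
have [uT [E [entE xyE coarse]]] :
    uniform_separator [set x] [set y].
  by apply: creg; [exact: accessible_closed_set1|move/eqP: nxy].
pose UT := Uniform.Pack uT.
have entE' := @entourage_split_ent UT _ entE.
have xA : nbhs x (xsection (@split_ent UT E) x).
  exact/coarse/(@nbhs_entourage UT).
have yB : nbhs y (xsection (@split_ent UT E)^-1%relation y).
  exact/coarse/(@nbhs_entourage UT)/(@entourage_inv UT).
have [z [/xsectionP xz /xsectionP zy]] := xy _ _ xA yB.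
have : ([set x] `*` [set y] `&` E) (x, y).
  by split => //; exact: (@entourage_split UT z).
by rewrite xyE.
Qed.

Lemma compact_regularP {X : topologicalType} (x : X) (O : set X) :
  hausdorff_space X -> compact [set: X] -> nbhs x O ->
  exists2 V, open_nbhs x V & closure V `<=` O.
Proof.
move=> hX cX /(compact_regular hX cX filterT)[V xV VO].
move: xV; rewrite nbhsE => -[W xW WV]; exists W => //.
exact: subset_trans (closureS WV) VO.
Qed.

Lemma retraction_fix {X : topologicalType} (r : X -> X) (x : X) :
  retraction r -> range r x -> r x = x.
Proof. by move=> [_ rr] [y _ <-]; rewrite -[LHS]/((r \o r) y) rr. Qed.

Lemma retraction_closed {X : topologicalType} (r : X -> X) :
  hausdorff_space X -> retraction r -> closed (range r).
Proof.
move=> hX rr x clx; exists x => //; apply: hX => A B rxA xB.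
have xA : nbhs x (r @^-1` A) by exact: rr.1 x A rxA.
have [_ [[v _ <-] [rA Bv]]] := clx _ (filterI xA xB).
exists (r v); split => //.
by rewrite -(retraction_fix r (r v) rr) //; exact: imageT.
Qed.

(** * Convergence of a directed system of retractions *)

(** Only the density of the union of the ranges connects the retractions to
    [x]; sequential continuity and compactness turn it into convergence of the
    whole net, by the construction of an increasing sequence that would
    otherwise violate sequential continuity. *)
Lemma compact_retractions_cvg {d : Order.disp_t} {Gamma : porderType d}
    {X : topologicalType} (r : Gamma -> X -> X) :
  hausdorff_space X -> compact [set: X] ->
  up_directed Gamma -> sigma_complete Gamma ->
  (forall s, retraction (r s)) ->
  (forall s t, (s <= t)%O -> range (r s) `<=` range (r t)) ->
  (forall (u : nat -> Gamma) s, increasing u -> is_sup u s ->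
    forall x, r (u n) x @[n --> \oo] --> r s x) ->
  dense (\bigcup_s range (r s)) ->
  forall x, r s x @[s --> tails Gamma] --> x.
Proof.
move=> hX cX dirG scG rr rmono rsup rdense x O xO.
apply: contrapT => nO.
have cof s : exists2 t, (s <= t)%O & ~ O (r t x).
  apply: contrapT => H; apply: nO; exists s => // t /= st.
  by apply: contrapT => nOt; apply: H; exists t.
have [O1 O1x O1O] := compact_regularP x O hX cX xO.
have [O2 [oO2 O2x] O2O1] := compact_regularP x O1 hX cX (open_nbhs_nbhs O1x).
(* A state [(s, G)] records an index and a neighbourhood of [x] mapped away from
   [x] by all retractions chosen so far.  The next index is taken above one
   whose range meets [G] close to [x]. *)
pose R (p q : Gamma * set X) := open_nbhs x p.2 ->
  [/\ (p.1 <= q.1)%O, open_nbhs x q.2, q.2 `<=` p.2,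
      q.2 `<=` r q.1 @^-1` (~` O1) &
      exists y, [/\ range (r q.1) y, p.2 y & O2 y]].
have step p : {q | R p q}.
  apply: cid; rewrite /R; case: p => s G /=.
  have [[oG Gx]|nG] := pselect (open_nbhs x G); last by exists (s, G).
  have [|y [[Gy O2y] [s' _ ys']]] := rdense (G `&` O2) _ (openI oG oO2).
    by exists x.
  have [s1 [ss1 s's1]] := dirG s s'.
  have [t s1t nOt] := cof s1.
  exists (t, G `&` r t @^-1` (~` closure O1)) => _; split => /=.
  - exact: Order.POrderTheory.le_trans ss1 s1t.
  - split; last by split => //= /O1O.
    apply: openI => //; apply: open_comp; first by move=> z _; exact: (rr t).1.
    exact/closed_openC/closed_closure.
  - by move=> z [].
  - by move=> z [_ /= nz /subset_closure].
  - exists y; split => //; apply: rmono ys'.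
    exact: Order.POrderTheory.le_trans s's1 s1t.
have [z0 [_ [s0 _ _]]] := rdense setT (ex_intro _ x I) openT.
have [f [f0 fR]] := dependent_choice step (s0, setT).
have fx n : open_nbhs x (f n).2.
  elim: n => [|n IH]; first by rewrite f0; split => //; exact: openT.
  by have [] := fR n IH.
pose u n := (f n).1.
have u_inc : increasing u.
  apply: (homo_leq (@Order.POrderTheory.le_refl _ _)) => [? ? ?|n].
    exact: Order.POrderTheory.le_trans.
  by have [] := fR n (fx n).
have Gdec m n : (m <= n)%N -> (f n).2 `<=` (f m).2.
  move: m n; apply: (homo_leq (r := fun A B : set X => B `<=` A)).
  - by move=> A; exact: subset_refl.
  - by move=> A B C AB BC; exact: subset_trans BC AB.
  - by move=> n; have [] := fR n (fx n).
have [s us] := scG u u_inc.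
have /choice[y yP] : forall n, exists y,
    [/\ range (r (u n.+1)) y, (f n).2 y & O2 y].
  by move=> n; have [] := fR n (fx n).
have ys n : range (r s) (y n).
  have [+ _ _] := yP n; apply: rmono; apply: us.1; exact: imageT.
have [e [_ ye]] := cX (y @ \oo) _ filterT.
have cly A m : (forall n, (m <= n)%N -> A (y n)) -> closure A e.
  move=> Ay; move: ye; rewrite clusterE; apply.
  by exists m => // n /=; exact: Ay.
(* The initial neighbourhood [setT] carries no constraint for [u 0], hence
   [u n.+1]. *)
have nO1 n : (~` O1) (r (u n.+1) e).
  have clO1 : closed (r (u n.+1) @^-1` (~` O1)).
    apply: preimage_closed; first by move=> z _; exact: (rr _).1.
    by apply: open_closedC; case: O1x.
  apply: clO1; apply: (cly _ n.+1) => k nk.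
  have [_ _ _ + _] := fR n (fx n); apply.
  by have [_ + _] := yP k; apply: Gdec.
have rse : r s e = e.
  by apply: retraction_fix => //; apply: retraction_closed => //; exact: (cly _ 0%N).
suff : (~` O1) e.
  by apply; apply: O2O1; apply: (cly _ 0%N) => n _; have [] := yP n.
rewrite -rse.
apply: (closed_cvg _ _ _ _ (rsup u s u_inc us e)).
  by apply: open_closedC; case: O1x.
by exists 1%N => // -[|n].
Qed.

(** * The retractions given by a weak skeleton *)

(** The axioms of a base for a topology are exactly what makes the members
    around a point a filter base. *)
Lemma members_filter {T : Type} (B : set (set T)) (A : set T) (x : T) :
  base_for_some_topology B ->
  (forall U, members_at B x U -> U `&` A !=set0) ->
  ProperFilter (filter_from (members_at B x) (fun U => U `&` A)).
Proof.
move=> [O [OT OI _] [BO OB]] BA.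
apply: filter_from_proper BA; apply: filter_from_filter.
  have [C CB CT] := OB _ OT; have : [set: T] x by [].
  by rewrite CT => -[U CU Ux]; exists U; split => //; exact: CB.
move=> U V [BU Ux] [BV Vx].
have [C CB CUV] := OB _ (OI _ _ (BO _ BU) (BO _ BV)).
have : (U `&` V) x by [].
rewrite CUV => -[W CW Wx]; exists W; first by split => //; exact: CB.
have WUV : W `<=` U `&` V by rewrite CUV; exact: bigcup_sup.
by move=> y [/WUV[Uy Vy] Ay].
Qed.

Section RetractionsOfWeakSkeleton.
Context {d : Order.disp_t} {Gamma : porderType d} {X : topologicalType}.
Context (F : Gamma -> set X) (psi : Gamma -> set (set X)).
Context (X_hausdorff : hausdorff_space X) (X_compact : compact [set: X]).
Context (Fpsi : weak_c_skeleton F psi).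

Lemma core_cluster s x : core F psi s x =
  cluster (filter_from (members_at (psi s) x) (fun U => U `&` F s)).
Proof.
rewrite clusterE eqEsubset; split => z zx.
  by move=> A [U xU]; move=> /closureS; apply; exact: zx.
by move=> U xU; apply: zx; exists U.
Qed.

Lemma trace_nonempty s U : psi s U -> U `&` F s !=set0.
Proof.
have [_ _ _ n0 psiU] := wsk_bases Fpsi s.
by apply/set0P/eqP => UF; apply: n0; exists U.
Qed.

Lemma members_nonempty s x : members_at (psi s) x !=set0.
Proof.
have [_ psib _ _] := wsk_bases Fpsi s.
have [|U xU _] := @filterT _ _ (members_filter _ setT x psib _).
  by move=> U [_ Ux]; exists x.
by exists U.
Qed.

Lemma core_nonempty s x : core F psi s x !=set0.
Proof.
rewrite core_cluster; have [_ psib _ _] := wsk_bases Fpsi s.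
have FP : ProperFilter (filter_from (members_at (psi s) x) (fun U => U `&` F s)).
  by apply: members_filter => // U [psiU _]; exact: trace_nonempty.
by have [z [_ zx]] := X_compact _ FP filterT; exists z.
Qed.

Lemma core_sub s x : core F psi s x `<=` F s.
Proof.
move=> z zx; have [U xU] := members_nonempty s x.
apply: (wsk_closed Fpsi).
by apply: closureS (zx U xU).
Qed.

(** Condition (3) is stated for members of [psi s]; since their traces form a
    base of [F s] and the core is contained in [F s], it extends to all
    neighbourhoods. *)
Lemma core_near {s x z} {O : set X} : core F psi s x z -> nbhs z O ->
  exists2 U, members_at (psi s) x U & closure (U `&` F s) `<=` O.
Proof.
move=> zx; rewrite nbhsE => -[O' [oO' O'z] O'O].
have [_ _ [_ +] _] := wsk_bases Fpsi s.
move=> /(_ (O' `&` F s))[|C CB CO]; first by exists O'.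
have : (O' `&` F s) z by split => //; exact: core_sub zx.
rewrite CO => -[A CA]; have [V psiV VA] := CB A CA.
rewrite -VA => -[Vz Fz].
have VO' : V `&` F s `<=` O' `&` F s by rewrite VA CO; exact: bigcup_sup CA.
have [U xU UV] := wsk_regular Fpsi zx (conj psiV Vz).
exists U => // y Uy; apply: O'O; suff [] : (O' `&` F s) y by [].
apply: VO'; split; first exact: UV.
apply: (wsk_closed Fpsi).
exact: closureS Uy.
Qed.

Lemma core_unique {s x z z'} : core F psi s x z -> core F psi s x z' -> z = z'.
Proof.
move=> zx z'x; apply: X_hausdorff => A B zA z'B.
have [U xU UA] := core_near zx zA.
have [W WB Wz'] : exists2 W, W `<=` B & open_nbhs z' W.
  by move: z'B; rewrite nbhsE => -[W ? ?]; exists W.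
have [y [Uy By]] := z'x U xU B z'B.
by exists y; split => //; apply: UA; exact: subset_closure.
Qed.

Context (r : Gamma -> X -> X) (rP : forall s x, core F psi s x (r s x)).

Lemma core_fix s x : F s x -> r s x = x.
Proof.
move=> Fx; apply: (core_unique (rP s x)) => U [_ Ux].
by apply: subset_closure.
Qed.

Lemma core_range s : range (r s) = F s.
Proof.
rewrite eqEsubset; split=> [_ [x _ <-]|x Fx]; first exact: core_sub (rP s x).
by exists x => //; exact: core_fix.
Qed.

(** The neighbourhood [U] given by [core_near] works at once for all of its
    points, because it is one of the sets that define their cores. *)
Lemma core_continuous s : continuous (r s).
Proof.
move=> x O /(core_near (rP s x))[U [psiU Ux] UO].
have [[_ psi_open] _ _ _] := wsk_bases Fpsi s.
have xU : nbhs x U by apply: open_nbhs_nbhs; split => //; exact: psi_open.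
apply: filterS xU => y Uy; apply: UO; exact: (rP s y).
Qed.

Lemma core_retraction s : retraction (r s).
Proof.
split; first exact: core_continuous.
by apply/funext => x /=; apply: core_fix; rewrite -core_range; exact: imageT.
Qed.

Lemma core_compose (star : star_condition F psi) s t : (s <= t)%O ->
  r s = r s \o r t /\ r s = r t \o r s.
Proof.
move=> st; split; apply/funext => x /=.
  apply/esym/(core_unique _ (rP s x)) => V xV.
  have [W zW WV] := star s t st x (r t x) (rP t x) V xV.
  by apply: WV; exact: (rP s (r t x)).
apply/esym/core_fix; apply: (wsk_mono Fpsi st).
by rewrite -core_range; exact: imageT.
Qed.

(** Condition double star lets the members of [psi (u n)] around [x] meet
    [closure (U `&` F s)] inside [F (u n)], so their traces cluster at a point
    of that closed set; this cluster point can only be [r (u n) x]. *)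
Lemma core_sup (dstar : double_star_condition F psi) (u : nat -> Gamma) s :
  increasing u -> is_sup u s -> forall x, r (u n) x @[n --> \oo] --> r s x.
Proof.
move=> u_inc us x O /(core_near (rP s x))[U xU UO].
have [m mP] := dstar u s u_inc us x U xU.
exists m => // n /= mn; apply: UO.
have [_ psib _ _] := wsk_bases Fpsi (u n).
pose K := closure (U `&` F s).
have FP : ProperFilter (filter_from (members_at (psi (u n)) x)
    (fun V => V `&` (K `&` F (u n)))).
  apply: members_filter => // V xV.
  by have [y [[Ky Vy] Fy]] := mP n mn V xV; exists y.
have [z [_ clz]] := X_compact _ FP filterT.
rewrite clusterE in clz.
have zx : core F psi (u n) x z.
  move=> V xV; apply: clz; exists V => // y [Vy [_ Fy]]; exact: conj.
rewrite (core_unique (rP (u n) x) zx).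
have clK : closed K by exact: closed_closure.
apply: clK.
have [V xV] := members_nonempty (u n) x.
by apply: clz; exists V => // y [_ []].
Qed.

Lemma core_r_skeleton : star_condition F psi -> double_star_condition F psi ->
  r_skeleton r.
Proof.
move=> star dstar; split.
- exact: wsk_directed Fpsi.
- exact: wsk_complete Fpsi.
- exact: core_retraction.
- by move=> s; rewrite core_range; apply: (wsk_cosmic Fpsi).
- exact: core_compose.
- exact: core_sup.
- apply: compact_retractions_cvg => //.
  + exact: wsk_directed Fpsi.
  + exact: wsk_complete Fpsi.
  + exact: core_retraction.
  + by move=> s t st; rewrite !core_range; exact: (wsk_mono Fpsi).
  + exact: core_sup.
  + by under eq_bigcupr do rewrite core_range; exact: wsk_dense Fpsi.
Qed.

End RetractionsOfWeakSkeleton.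

(** * Countable bases of compact cosmic subspaces *)

(** Two distinct points of [A] have disjoint neighbourhoods in [X], which contain
    members of the network around these points.  So it suffices to choose one
    separating open set for each separable pair of members of the network: the
    chosen sets generate a Hausdorff topology coarser than that of the compact
    set [A], and such a topology is not strictly coarser. *)
Lemma cosmic_countable_base {X : topologicalType} (A : set X) :
  hausdorff_space X -> compact [set: X] -> closed A -> cosmic (set_type A) ->
  exists B : set (set X), [/\ countable B, B `<=` open &
    forall x O, A x -> nbhs x O -> exists V, [/\ B V, V x & V `&` A `<=` O]].
Proof.
move=> hX cX clA [N cN netN].
pose sep (P : set (set_type A) * set (set_type A)) (U : set X) :=
  exists V, [/\ open U, open V, set_val @` P.1 `<=` U, set_val @` P.2 `<=` V &
    U `&` V = set0].
have /choice[f fP] : forall P, exists U, open U /\ ((exists U', sep P U') -> sep P U).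
  move=> P; have [[U PU]|nPU] := pselect (exists U, sep P U).
    by exists U; split => //; case: PU => V [].
  by exists setT; split => //; exact: openT.
(* Finite intersections of the chosen sets [f P], one for each pair [P] of
   members of the network, form the base. *)
pose S := f @` (N `*` N).
have cS : countable S.
  by apply: (card_le_trans (card_image_le _ _)); exact: countableX.
exists (finI_from S id); split.
- exact: finI_from_countable.
- move=> _ [D DS <-]; rewrite openE => x Dx; apply: filter_bigI => U DU.
  apply: open_nbhs_nbhs; split; last exact: Dx.
  by have /set_mem[P _ <-] := DS _ DU; have [] := fP P.
move=> x O Ax; rewrite nbhsE => -[O' [oO' O'x] O'O].
have ST : finI_from S id setT.
  by exists fset0 => //; rewrite set_fset0 bigcap_set0.
apply: contrapT => nV.
(* If no member fits into [O'], the members around [x] cluster at a point [y] of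
   [A] outside [O'], which contradicts the separation of [x] and [y]. *)
have FF : ProperFilter (filter_from [set V | finI_from S id V /\ V x]
    (fun V => V `&` (A `\` O'))).
  apply: filter_from_proper; first apply: filter_from_filter.
  - by exists setT.
  - move=> U V [SU Ux] [SV Vx]; exists (U `&` V).
      by split => //; exact: finI_fromI.
    by move=> y [[]].
  - move=> V [SV Vx]; apply: contrapT => n0; apply: nV; exists V; split => //.
    move=> y [Vy Ay]; apply: O'O; apply: contrapT => nOy; apply: n0.
    by exists y.
have [y [_ ycl]] := cX _ FF filterT.
rewrite clusterE in ycl.
have [Ay nOy] : (A `\` O') y.
  have clAO' : closed (A `\` O') by apply: closedI => //; exact: open_closedC.
  apply: clAO'; apply: ycl; exists setT; first by split.
  by move=> z [].
have xy : x <> y by move=> xy; apply: nOy; rewrite -xy.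
move: hX; rewrite open_hausdorff => /(_ x y).
case; first exact/eqP.
move=> [U V] /= [/set_mem Ux /set_mem Vy] [oU oV /eqP UV].
have netA z W (Az : A z) : open W -> W z ->
    exists M : set (set_type A), [/\ N M, (set_val @` M) z & set_val @` M `<=` W].
  move=> oW Wz.
  have [||M NM [Mz MW]] := netN (exist _ z (mem_set Az)) (set_val @^-1` W).
  - by exists W.
  - by [].
  - exists M; split => //; first by exists (exist _ z (mem_set Az)).
    by move=> _ [w Mw <-]; exact: MW.
have [M [NM Mx MU]] := netA x U Ax oU Ux.
have [M' [NM' M'y MV]] := netA y V Ay oV Vy.
have [_ [|V' [_ oV' MfM MV' fV']]] := fP (M, M').
  by exists U, V; split.
have [] : f (M, M') `&` (A `\` O') `&` V' !=set0.
  apply: ycl; last by apply: open_nbhs_nbhs; split => //; exact: MV'.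
  exists (f (M, M')) => //; split; last exact: MfM.
  by apply: (@finI_from1 _ _ S id (f (M, M'))); exists (M, M').
move=> z [[fz _] V'z].
by have : (f (M, M') `&` V') z by []; rewrite fV'.
Qed.

(** * The weak skeleton given by retractions *)

Section WeakSkeletonOfRetractions.
Context {d : Order.disp_t} {Gamma : porderType d} {X : topologicalType}.
Context (r : Gamma -> X -> X).
Context (X_hausdorff : hausdorff_space X) (X_compact : compact [set: X]).
Context (rsk : r_skeleton r).

Let F s := range (r s).

Context (B : Gamma -> set (set X)).
Context (B_countable : forall s, countable (B s)).
Context (B_open : forall s, B s `<=` open).
Context (B_base : forall s x O, F s x -> nbhs x O ->
  exists V, [/\ B s V, V x & V `&` F s `<=` O]).

(** Preimages of base members that miss [F s] are empty and have to be left
    out, as [psi s] may not contain a set with empty trace. *)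
Let psi s := [set r s @^-1` V | V in [set V | B s V /\ V `&` F s !=set0]].

Let r_fix s x : F s x -> r s x = x.
Proof. exact: retraction_fix (rsk_retraction rsk s). Qed.

Let F_closed s : closed (F s).
Proof. exact: retraction_closed X_hausdorff (rsk_retraction rsk s). Qed.

Let F_mono s t : (s <= t)%O -> F s `<=` F t.
Proof.
move=> st _ [x _ <-]; have [_ ->] := rsk_compose rsk st.
exact: imageT.
Qed.

Lemma preimage_trace s V : r s @^-1` V `&` F s = V `&` F s.
Proof.
by rewrite eqEsubset; split=> x [/= Vx Fx]; split => //=; move: Vx; rewrite r_fix.
Qed.

Lemma preimage_base s x O : nbhs (r s x) O ->
  exists U, [/\ psi s U, U x & U `<=` r s @^-1` O].
Proof.
move=> /(B_base s (r s x) O (imageT _ _))[V [BV Vx VO]].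
exists (r s @^-1` V); split => //.
  by exists V => //; split => //; exists (r s x); split => //; exact: imageT.
by move=> y Vy; apply: VO; split => //; exact: imageT.
Qed.

Lemma core_preimage s x : core F psi s x = [set r s x].
Proof.
rewrite eqEsubset; split => [z zx|_ ->].
  apply: X_hausdorff => P Q zP xQ.
  have [U [psiU Ux UQ]] := preimage_base s x Q xQ.
  have [y [[Uy Fy] Py]] := zx U (conj psiU Ux) P zP.
  by exists y; split => //; rewrite -(r_fix s y Fy); exact: UQ.
move=> _ [[V [BV _] <-] Vx]; apply: subset_closure; split; last exact: imageT.
by rewrite /= r_fix//; exact: imageT.
Qed.

Lemma preimage_assignment : assignment_of_bases F psi.
Proof.
move=> s; have [rc _] := rsk_retraction rsk s.
(* The preimages of open sets form a topology with base [psi s]; its trace on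
   [F s] is the subspace topology by [preimage_trace]. *)
have unions W : open W -> r s @^-1` W =
    \bigcup_(U in [set U | psi s U /\ U `<=` r s @^-1` W]) U.
  move=> oW; rewrite eqEsubset; split => [x Wx|x [U [_ UW] /UW//]].
  have [U [psiU Ux UW]] := preimage_base s x W (open_nbhs_nbhs (conj oW Wx)).
  by exists U.
split.
- split.
    apply: (card_le_trans (card_image_le _ _)).
    by apply: sub_countable (B_countable s); apply: subset_card_le => V [].
  move=> _ [V [BV _] <-]; apply: open_comp; first by move=> *; exact: rc.
  exact: B_open BV.
- exists [set r s @^-1` W | W in open].
    split; first by exists setT => //; exact: openT.
      move=> _ _ [V oV <-] [W oW <-]; exists (V `&` W) => //; exact: openI.
    move=> C Copen; exists (\bigcup_(W in [set W | open W /\ C (r s @^-1` W)]) W).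
      by apply: bigcup_open => W [].
    rewrite eqEsubset; split => [x [W [_ CW] Wx]|x [U CU Ux]].
      by exists (r s @^-1` W).
    have [W oW WU] := Copen U CU; exists W; first by split => //; rewrite WU.
    by move: Ux; rewrite -WU.
  split; first by move=> _ [V [BV _] <-]; exists V => //; exact: B_open BV.
  by move=> _ [W oW <-]; eexists; last exact: unions; move=> U [].
- split.
    move=> _ [_ [V [BV _] <-] <-]; rewrite preimage_trace.
    by exists V => //; exact: B_open BV.
  move=> _ [W oW <-].
  exists [set U `&` F s | U in [set U | psi s U /\ U `<=` r s @^-1` W]].
    by move=> _ [U [psiU _] <-]; exists U.
  by rewrite -preimage_trace [in LHS](unions W oW) setI_bigcupl bigcup_image.
- move=> [_ [V [_ VF] <-]]; rewrite preimage_trace.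
  by apply/eqP/set0P.
Qed.

Lemma preimage_weak_skeleton : weak_c_skeleton F psi.
Proof.
split.
- exact: rsk_directed rsk.
- exact: rsk_complete rsk.
- exact: F_closed.
- exact: rsk_cosmic rsk.
- exact: F_mono.
- move=> O [x Ox] oO.
  have [s _ sO] := @rsk_limit _ _ _ _ rsk x O (open_nbhs_nbhs (conj oO Ox)).
  exists (r s x); split; first by apply: sO => /=.
  by exists s => //; exact: imageT.
- exact: preimage_assignment.
- move=> s x z; rewrite core_preimage => -> V [[W [BW _] <-] /= Wx].
  have rrx : r s (r s x) = r s x by apply: r_fix; exact: imageT.
  rewrite rrx in Wx.
  have [O xO OW] := compact_regularP (r s x) W X_hausdorff X_compact
    (open_nbhs_nbhs (conj (B_open s W BW) Wx)).
  have [U [psiU Ux UO]] := preimage_base s x O (open_nbhs_nbhs xO).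
  exists U => // y yU.
  have Fy : F s y.
    by apply: F_closed; apply: closureS yU.
  rewrite /= r_fix//; apply: OW; apply: closureS yU => w [/UO + Fw].
  by rewrite /= r_fix.
Qed.

(** The core of [x] at [t] is [r t x], which [r s] does not tell apart from [x];
    so [V] itself serves as [W]. *)
Lemma preimage_star : star_condition F psi.
Proof.
move=> s t st x z; rewrite core_preimage => -> V [psiV Vx].
exists V => //; split => //; move: psiV Vx => [W _ <-] /=.
have [srt _] := rsk_compose rsk st.
by rewrite -[r s (r t x)]/((r s \o r t) x) -srt.
Qed.

(** For large [n] the point [r (u n) x] itself lies in the required
    intersection. *)
Lemma preimage_double_star : double_star_condition F psi.
Proof.
move=> u s u_inc us x U [[W [BW _] <-] /= Wx].
have [m _ mW] := @rsk_sup _ _ _ _ rsk u s u_inc us x _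
  (open_nbhs_nbhs (conj (B_open s W BW) Wx)).
exists m => n mn V [[W' _ <-] /= W'x].
have Fnx : F (u n) (r (u n) x) by exact: imageT.
have Fsx : F s (r (u n) x).
  by apply: F_mono Fnx; apply: us.1; exact: imageT.
exists (r (u n) x); split; last by [].
split; last by rewrite /= r_fix.
apply: subset_closure; split => //=.
by rewrite r_fix//; exact: mW.
Qed.

End WeakSkeletonOfRetractions.

Theorem theorem6p6 (X : topologicalType) (X_tychonoff : tychonoff_space X)
    (X_compact : compact [set: X]) :
  (exists (d : Order.disp_t) (Gamma : porderType d)
      (F : Gamma -> set X) (psi : Gamma -> set (set X)),
    [/\ weak_c_skeleton F psi, star_condition F psi & double_star_condition F psi])
  <->
  (exists (d : Order.disp_t) (Gamma : porderType d) (r : Gamma -> X -> X),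
    r_skeleton r).
Proof.
have X_hausdorff := tychonoff_hausdorff X_tychonoff.
split=> [[d [Gamma [F [psi [Fpsi star dstar]]]]]|[d [Gamma [r rsk]]]].
  have [r rP] := choice (fun p => core_nonempty F psi X_compact Fpsi p.1 p.2).
  exists d, Gamma, (fun s x => r (s, x)); apply: (core_r_skeleton F psi) => //.
  by move=> s x; exact: rP (s, x).
have /choice[B BP] := fun s => cosmic_countable_base (range (r s)) X_hausdorff
  X_compact (retraction_closed _ X_hausdorff (rsk_retraction rsk s))
  (rsk_cosmic rsk s).
have B_countable s : countable (B s) by have [] := BP s.
have B_open s : B s `<=` open by have [] := BP s.
exists d, Gamma; eexists; eexists; split.
- apply: (preimage_weak_skeleton r X_hausdorff X_compact rsk B) => // s.
  by have [] := BP s.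
- apply: preimage_star => // s; by have [] := BP s.
- exact: preimage_double_star.
Qed.
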